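(* Let $\omega_1, \omega_2, \omega_3 \in \mathbb{C}$ with $|\omega_i|\le 1$ for $i=1,2,3$, and let $\alpha_1,\alpha_2,\beta\in\mathbb{C}$. Then the matrix $$T = \begin{pmatrix}\omega_1 & \alpha_1 & \beta \\ 0 & \omega_2 & \alpha_2 \\ 0 & 0 & \omega_3\end{pmatrix}$$ is a contraction when acting on the Hilbert space $\mathbb{C}^3$ if and only if one of the following two sets of conditions holds: (i) $|\omega_2| < 1$, $$\left|\alpha_i\right|^2 \leq (1-|\omega_i|^2)(1-|\omega_{i+1}|^2), \quad i=1,2,$$ and $$\left|\beta (1-|\omega_2|^2)+\alpha_1\alpha_2\overline{\omega_2}\right|^2 \le \left[(1-|\omega_1|^2)(1-|\omega_2|^2) - |\alpha_1|^2\right] \cdot \left[(1-|\omega_2|^2)(1-|\omega_3|^2) - |\alpha_2|^2 \right];$$ or (ii) $|\omega_2| =1$, $\alpha_1=\alpha_2=0$, and $$|\beta|^2 \leq (1-|\omega_1|^2)(1-|\omega_3|^2).$$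
   Context: $\mathbb{C}^3$ carries its usual Euclidean (Hilbert) norm; a contraction is an operator of operator norm at most $1$. *)

(* Defs.v *)
From mathcomp Require Import all_boot all_order all_algebra complex.
From mathcomp Require Import classical_sets reals.

Set Implicit Arguments.
Unset Strict Implicit.
Unset Printing Implicit Defensive.

Import Order.TTheory GRing.Theory Num.Theory.

Local Open Scope ring_scope.
Local Open Scope complex_scope.
Local Open Scope classical_set_scope.

(* [Normc.normc] is the R-valued modulus; [`|z|] is the same number seen in
   R[i]. *)
Definition l2norm (R : realType) (n : nat) (x : 'cV[R[i]]_n) : R :=
  Num.sqrt (\sum_(i < n) Normc.normc (x i 0) ^+ 2).

Definition opnorm (R : realType) (m n : nat) (T : 'M[R[i]]_(m, n)) : R :=
  sup [set l2norm (T *m x) | x in [set x : 'cV[R[i]]_n | l2norm x <= 1]].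

(* [sup] is 0 on sets without a supremum; [opnorm] never hits that case. *)
Lemma opnorm_has_sup (R : realType) (m n : nat) (T : 'M[R[i]]_(m, n)) :
  has_sup [set l2norm (T *m x) | x in [set x : 'cV[R[i]]_n | l2norm x <= 1]].
Proof.
have nE (z : R[i]) : `|z| = (Normc.normc z)%:C by case: z.
have n0 (z : R[i]) : 0 <= Normc.normc z by case: z => a b; exact: sqrtr_ge0.
have nsum (F : 'I_n -> R[i]) :
    Normc.normc (\sum_j F j) <= \sum_j Normc.normc (F j).
  rewrite -lecR -nE rmorph_sum /=; apply: le_trans (ler_norm_sum _ _ _) _.
  by apply: ler_sum => j _; rewrite nE.
split.
  exists (l2norm (T *m 0)), 0 => //=.
  rewrite /l2norm big1 ?sqrtr0 ?ler01// => i _.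
  by rewrite mxE Normc.normc0 expr0n.
exists (Num.sqrt (\sum_i (\sum_j Normc.normc (T i j)) ^+ 2)) => _ [x /= x1 <-].
apply: ler_wsqrtr; apply: ler_sum => i _.
have S0 : 0 <= \sum_j Normc.normc (T i j) by apply: sumr_ge0 => j _.
rewrite ler_sqr ?nnegrE // mxE; apply: le_trans (nsum _) _.
apply: ler_sum => j _; rewrite Normc.normcM ler_piMr //.
apply: le_trans x1; rewrite -[leLHS]ger0_norm // -sqrtr_sqr ler_wsqrtr //.
by rewrite (bigD1 j) //= lerDl sumr_ge0 // => k _; exact: sqr_ge0.
Qed.

Definition contraction (R : realType) (m n : nat) (T : 'M[R[i]]_(m, n)) : Prop :=
  opnorm T <= 1.

Definition upper_tri3 (R : realType) (w1 w2 w3 a1 a2 b : R[i]) : 'M[R[i]]_3 :=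
  \matrix_(i < 3, j < 3)
    nth 0 (nth [::] [:: [:: w1; a1; b]; [:: 0; w2; a2]; [:: 0; 0; w3]] i) j.

(* Main.v *)
Require Import Defs.
From mathcomp Require Import all_boot all_order all_algebra complex.
From mathcomp Require Import classical_sets reals.
From mathcomp Require Import ring.

Set Implicit Arguments.
Unset Strict Implicit.
Unset Printing Implicit Defensive.

Import Order.TTheory GRing.Theory Num.Theory.

Local Open Scope ring_scope.

(** The matrix [T] is a contraction when the Hermitian form [|v|^2 - |T v|^2]
    in [v = (x, y, z)] is nonnegative.  Its coefficients in [x] may degenerate
    ([1 - |w1|^2] can vanish), so taking a Schur complement with respect to
    [x] is awkward.  The cure is to linearise the square in the first row:
    [- |t|^2] is the minimum over [u] of [|u|^2 - 2 Re (u^* t)], attained at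
    [u = t].  For fixed [u] the variable [x] then occurs with coefficient [1],
    and minimising over it leaves a form [G] in [(u, y, z)]
    ([reduced_form], [row_form_ge0P]) whose [y]-coefficient is
    [p2 = 1 - |w2|^2].

    If [0 < p2], completing the square in [y] leaves the binary form in
    [(u, z)] with diagonal coefficients [(1 - |w1|^2) p2 - |a1|^2] and
    [p2 (1 - |w3|^2) - |a2|^2] and off-diagonal coefficient
    [b p2 + a1 a2 w2^*].  Its positivity ([binary_form_ge0P]) is condition (i).

    If [p2 = 0], the form is affine in [y], hence bounded below only if its
    linear part [w2^* a2 z + a1^* u] vanishes identically
    ([affine_ge0_eq0]); as [w2 <> 0] this says [a1 = a2 = 0], and the
    positivity of the remaining binary form in [(u, z)] is condition (ii). *)

(** * Positivity of Hermitian forms in few variables *)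

(** Clears norms in favour of products [z * z^*] and pushes conjugation down
    to the variables, so that [ring] sees only [z] and [z^*]. *)
Ltac herm_ring :=
  rewrite !normCK;
  (* Two passes, as conjugates of sums and products can be nested. *)
  do 2!rewrite ?(rmorphD, rmorphB, rmorphN, rmorphM, rmorph1, rmorph0, conjCK) /=;
  ring.

Section Forms.
Variable C : numClosedFieldType.
Implicit Types (A B D K v w b u x y z : C).

Lemma affine_ge0_eq0 K v :
  (forall y, 0 <= K - (y^* * v + y * v^*)) -> v = 0.
Proof.
move=> H; apply/eqP/negP => /negP v0.
have K0 : 0 <= K by have := H 0; rewrite rmorph0 !mul0r addr0 subr0.
have n0 : `|v| ^+ 2 != 0 by rewrite expf_neq0 // normr_eq0.
pose k := (K + 1) / `|v| ^+ 2.
have kR : k^* = k.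
  by apply: conj_Creal; rewrite ger0_real // divr_ge0 ?addr_ge0 ?exprn_ge0.
(* Going far enough along [v] makes the form equal to [- K - 2]. *)
have := H (k * v); rewrite rmorphM /= kR.
have -> : K - (k * v^* * v + k * v * v^*) = - (K + 1 + 1).
  have -> : k * v^* * v + k * v * v^* = (k * `|v| ^+ 2) * 2.
    by rewrite normCK; ring.
  by rewrite /k divfK //; ring.
by rewrite oppr_ge0 => /le_gtF; rewrite !ltr_wpDl ?addr_ge0.
Qed.

Lemma binary_form_ge0P A B D :
  (forall u z, 0 <= A * `|u| ^+ 2 + D * `|z| ^+ 2
                    - (u^* * B * z + u * B^* * z^*)) <->
  [/\ 0 <= A, 0 <= D & `|B| ^+ 2 <= A * D].
Proof.
split=> [H|[A0 D0 BAD] u z].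
  have A0 : 0 <= A.
    have := H 1 0; congr (0 <= _).
    by herm_ring.
  have D0 : 0 <= D.
    have := H 0 1; congr (0 <= _).
    by herm_ring.
  split=> //; move: A0; rewrite le_eqVlt => /predU1P[A0|Agt0].
    suff -> : B = 0 by rewrite -A0 normr0 expr0n mul0r.
    apply: (@affine_ge0_eq0 D) => y; have := H y 1; congr (0 <= _).
    by rewrite -A0; herm_ring.
  rewrite -subr_ge0 -(pmulr_rge0 _ Agt0).
  (* [(B, A)] is [A] times the minimiser [u = B z / A] at [z = 1]. *)
  have := H B A; congr (0 <= _).
  have AR : A^* = A by apply: conj_Creal; rewrite ger0_real ?ltW.
  by rewrite !normCK AR; ring.
move: A0; rewrite le_eqVlt => /predU1P[A0|Agt0].
  have /eqP -> : B == 0.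
    by rewrite -normr_eq0 -sqrf_eq0 eq_le exprn_ge0 // andbT -(mul0r D) A0.
  rewrite -A0 rmorph0 !(mulr0, mul0r) add0r addr0 subr0.
  by rewrite mulr_ge0 ?exprn_ge0.
have AR : A^* = A by apply: conj_Creal; rewrite ger0_real ?ltW.
rewrite -(pmulr_rge0 _ Agt0).
have -> : A * (A * `|u| ^+ 2 + D * `|z| ^+ 2
               - (u^* * B * z + u * B^* * z^*))
        = `|A * u - B * z| ^+ 2 + (A * D - `|B| ^+ 2) * `|z| ^+ 2.
  by rewrite !normCK rmorphB !rmorphM /= AR; ring.
by rewrite addr_ge0 ?mulr_ge0 ?exprn_ge0 ?subr_ge0.
Qed.

(** * Elimination of the first coordinate *)

Variables (w1 w2 w3 a1 a2 b : C).

Definition row_form x y z : C :=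
  `|x| ^+ 2 + `|y| ^+ 2 + `|z| ^+ 2
  - (`|w1 * x + a1 * y + b * z| ^+ 2 + `|w2 * y + a2 * z| ^+ 2
     + `|w3 * z| ^+ 2).

(** The dual variable [u] stands for the first coordinate of the image. *)
Definition reduced_form u y z : C :=
  (1 - `|w1| ^+ 2) * `|u| ^+ 2 + (1 - `|w3| ^+ 2 - `|a2| ^+ 2) * `|z| ^+ 2
  + (1 - `|w2| ^+ 2) * `|y| ^+ 2
  - (y^* * (w2^* * a2 * z + a1^* * u)
     + y * (w2^* * a2 * z + a1^* * u)^*)
  - (u^* * b * z + u * b^* * z^*).

(** Both forms are partial minima of [row_form + |u - t|^2], where [t] is the
    first coordinate of the image: over [u] at [u = t], and over [x] at
    [x = w1^* u]. *)
Lemma row_formD x y z u :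
  row_form x y z + `|u - (w1 * x + a1 * y + b * z)| ^+ 2
  = reduced_form u y z + `|x - w1^* * u| ^+ 2.
Proof. by rewrite /row_form /reduced_form; herm_ring. Qed.

Lemma row_form_ge0P :
  (forall x y z, 0 <= row_form x y z) <->
  (forall u y z, 0 <= reduced_form u y z).
Proof.
split=> H.
  move=> u y z; have := row_formD (w1^* * u) y z u.
  rewrite subrr normr0 expr0n addr0 => <-.
  by rewrite addr_ge0 ?exprn_ge0.
move=> x y z; have := row_formD x y z (w1 * x + a1 * y + b * z).
rewrite subrr normr0 expr0n addr0 => ->.
by rewrite addr_ge0 ?exprn_ge0.
Qed.

(** * Elimination of the second coordinate *)

Let p2 := 1 - `|w2| ^+ 2.

Definition corner_form u z : C :=
  ((1 - `|w1| ^+ 2) * p2 - `|a1| ^+ 2) * `|u| ^+ 2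
  + (p2 * (1 - `|w3| ^+ 2) - `|a2| ^+ 2) * `|z| ^+ 2
  - (u^* * (b * p2 + a1 * a2 * w2^*) * z
     + u * (b * p2 + a1 * a2 * w2^*)^* * z^*).

(** The factor [1 - |w2|^2] on the left keeps the completed square
    free of division. *)
Lemma reduced_form_square u y z :
  p2 * reduced_form u y z
  = `|p2 * y - (w2^* * a2 * z + a1^* * u)| ^+ 2 + corner_form u z.
Proof. by rewrite /corner_form /reduced_form /p2; herm_ring. Qed.

Lemma reduced_form_ge0P_lt1 : `|w2| < 1 ->
  (forall u y z, 0 <= reduced_form u y z) <->
  (forall u z, 0 <= corner_form u z).
Proof.
move=> w2lt1.
have p2gt0 : 0 < p2 by rewrite subr_gt0 expr_lt1.
split=> [H u z|H u y z]; last first.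
  by rewrite -(pmulr_rge0 _ p2gt0) reduced_form_square addr_ge0 ?exprn_ge0.
pose y := (w2^* * a2 * z + a1^* * u) / p2.
have := H u y z; rewrite -(pmulr_rge0 _ p2gt0) reduced_form_square.
by rewrite /y mulrC divfK ?gt_eqF // subrr normr0 expr0n add0r.
Qed.

Lemma reduced_form_ge0P_eq1 : `|w2| = 1 ->
  (forall u y z, 0 <= reduced_form u y z) <->
  [/\ a1 = 0, a2 = 0 &
      forall u z, 0 <= (1 - `|w1| ^+ 2) * `|u| ^+ 2
                       + (1 - `|w3| ^+ 2) * `|z| ^+ 2
                       - (u^* * b * z + u * b^* * z^*)].
Proof.
move=> w2E; have w20 : w2^* != 0 by rewrite conjC_eq0 -normr_eq0 w2E oner_eq0.
have formE u y z : a1 = 0 -> a2 = 0 -> reduced_form u y z =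
    (1 - `|w1| ^+ 2) * `|u| ^+ 2 + (1 - `|w3| ^+ 2) * `|z| ^+ 2
    - (u^* * b * z + u * b^* * z^*).
  move=> a10 a20; rewrite /reduced_form w2E a10 a20.
  rewrite rmorph0 !(mulr0, mul0r, addr0) rmorph0 normr0.
  by ring.
split=> [H|[a10 a20 H] u y z]; last by rewrite formE.
have lin u z : w2^* * a2 * z + a1^* * u = 0.
  pose K := (1 - `|w1| ^+ 2) * `|u| ^+ 2
    + (1 - `|w3| ^+ 2 - `|a2| ^+ 2) * `|z| ^+ 2
    - (u^* * b * z + u * b^* * z^*).
  apply: (@affine_ge0_eq0 K) => y; have := H u y z; congr (0 <= _).
  by rewrite /K /reduced_form w2E; ring.
have a10 : a1 = 0.
  by apply/eqP; rewrite -conjC_eq0 -[a1^*]mulr1 -(lin 1 0) mulr0 add0r.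
have a20 : a2 = 0.
  apply/eqP; move/eqP: (lin 0 1).
  by rewrite mulr0 addr0 mulr1 mulf_eq0 (negbTE w20).
by split=> // u z; rewrite -(formE u 0 z).
Qed.

(** The bounds on [a1] and [a2] are the signs of the diagonal coefficients of
    [corner_form]; the last inequality of each case says that the
    determinant of a binary form in [(u, z)] is nonnegative. *)
Lemma row_form_criterion : `|w1| <= 1 -> `|w2| <= 1 -> `|w3| <= 1 ->
  (forall x y z, 0 <= row_form x y z) <->
  ((`|w2| < 1 /\
    `|a1| ^+ 2 <= (1 - `|w1| ^+ 2) * (1 - `|w2| ^+ 2) /\
    `|a2| ^+ 2 <= (1 - `|w2| ^+ 2) * (1 - `|w3| ^+ 2) /\
    `|b * (1 - `|w2| ^+ 2) + a1 * a2 * w2^*| ^+ 2 <=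
      ((1 - `|w1| ^+ 2) * (1 - `|w2| ^+ 2) - `|a1| ^+ 2) *
      ((1 - `|w2| ^+ 2) * (1 - `|w3| ^+ 2) - `|a2| ^+ 2))
   \/
   (`|w2| = 1 /\ a1 = 0 /\ a2 = 0 /\
    `|b| ^+ 2 <= (1 - `|w1| ^+ 2) * (1 - `|w3| ^+ 2))).
Proof.
move=> w1le1 w2le1 w3le1; rewrite row_form_ge0P.
case: (eqVneq `|w2| 1) => [w2E|w2N].
  rewrite (reduced_form_ge0P_eq1 w2E); split.
    by case=> a10 a20 /binary_form_ge0P[_ _ bD]; right.
  case=> [[]|[_ [a10 [a20 bD]]]]; first by rewrite w2E ltxx.
  split=> //; apply/binary_form_ge0P.
  by split; rewrite // subr_ge0 exprn_ile1.
have w2lt1 : `|w2| < 1 by rewrite lt_neqAle w2N.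
rewrite (reduced_form_ge0P_lt1 w2lt1) /corner_form binary_form_ge0P.
rewrite !subr_ge0; split; first by case=> A0 D0 BD; left.
by case=> [[_ [A0 [D0 BD]]]|[w2E]]; [split | rewrite w2E eqxx in w2N].
Qed.

End Forms.

(** * Contractions as norm-decreasing maps *)

Section Contraction.
Variable R : realType.

Lemma normrE_normc (z : R[i]) : `|z| = ((Normc.normc z)%:C)%C.
Proof. by case: z. Qed.

Lemma l2norm_ge0 n (x : 'cV[R[i]]_n) : 0 <= l2norm x.
Proof. exact: sqrtr_ge0. Qed.

Lemma l2norm_sqr n (x : 'cV[R[i]]_n) :
  ((l2norm x ^+ 2)%:C)%C = \sum_i `|x i 0| ^+ 2.
Proof.
rewrite sqr_sqrtr; last by apply: sumr_ge0 => i _; exact: sqr_ge0.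
rewrite rmorph_sum; apply: eq_bigr => i _.
by rewrite normrE_normc rmorphXn.
Qed.

Lemma l2normZ n (a : R) (x : 'cV[R[i]]_n) :
  0 <= a -> l2norm ((a%:C)%C *: x) = a * l2norm x.
Proof.
move=> a0; rewrite -[in RHS](ger0_norm a0) -sqrtr_sqr -sqrtrM ?sqr_ge0 //.
rewrite mulr_sumr; congr Num.sqrt; apply: eq_bigr => i _.
rewrite mxE Normc.normcM exprMn /= expr0n /= addr0 sqrtr_sqr.
by rewrite real_normK ?num_real.
Qed.

Lemma contractionP m n (T : 'M[R[i]]_(m, n)) :
  contraction T <-> forall x, l2norm (T *m x) <= l2norm x.
Proof.
split=> [T1 x|H]; last first.
  apply: ge_sup; first by have [] := opnorm_has_sup T.
  by move=> _ [x /= x1 <-]; exact: le_trans (H x) x1.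
have le_unit y : l2norm y <= 1 -> l2norm (T *m y) <= 1.
  move=> y1; apply: le_trans T1; apply: sup_upper_bound.
    exact: opnorm_has_sup.
  by exists y.
(* Normalising by [|x| + e] instead of [|x|] covers [x = 0] as well. *)
apply/ler_addgt0Pr => e e0.
pose k := l2norm x + e.
have k0 : 0 < k by rewrite ltr_wpDl ?l2norm_ge0.
have kV : 0 <= k^-1 by rewrite invr_ge0 ltW.
have := le_unit ((k^-1%:C)%C *: x).
rewrite -scalemxAr !l2normZ // !ler_pdivrMl // !mulr1; apply.
by rewrite lerDl ltW.
Qed.

Lemma contraction_upper_tri3P (w1 w2 w3 a1 a2 b : R[i]) :
  contraction (upper_tri3 w1 w2 w3 a1 a2 b) <->
  forall x y z, 0 <= row_form w1 w2 w3 a1 a2 b x y z.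
Proof.
have form_col (v : 'cV[R[i]]_3) :
    (l2norm (upper_tri3 w1 w2 w3 a1 a2 b *m v) <= l2norm v)
    = (0 <= row_form w1 w2 w3 a1 a2 b
              (v 0 0) (v 1 0) (v (inord 2) 0)).
  have i2 : inord 2 = lift ord0 (lift ord0 ord0) :> 'I_3.
    by apply/val_inj; rewrite /= inordK.
  have i1 : 1 = lift ord0 ord0 :> 'I_3 by apply/val_inj.
  rewrite -ler_sqr ?nnegrE ?l2norm_ge0 // -lecR !l2norm_sqr -subr_ge0.
  congr (0 <= _); rewrite /row_form i2 i1 !big_ord_recl !big_ord0 !mxE.
  rewrite !big_ord_recl !big_ord0 !mxE /= !(mul0r, add0r, addr0).
  by rewrite !addrA.
rewrite contractionP; split=> [H x y z|H v]; last by rewrite form_col.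
have := H (\col_i nth 0 [:: x; y; z] i).
by rewrite form_col !mxE inordK.
Qed.

End Contraction.

Theorem theorem2p3 (R : realType) (w1 w2 w3 a1 a2 b : R[i])
    (hw1 : `|w1| <= 1) (hw2 : `|w2| <= 1) (hw3 : `|w3| <= 1) :
  contraction (upper_tri3 w1 w2 w3 a1 a2 b) <->
  ((`|w2| < 1 /\
    `|a1| ^+ 2 <= (1 - `|w1| ^+ 2) * (1 - `|w2| ^+ 2) /\
    `|a2| ^+ 2 <= (1 - `|w2| ^+ 2) * (1 - `|w3| ^+ 2) /\
    `|b * (1 - `|w2| ^+ 2) + a1 * a2 * w2^*| ^+ 2 <=
      ((1 - `|w1| ^+ 2) * (1 - `|w2| ^+ 2) - `|a1| ^+ 2) *
      ((1 - `|w2| ^+ 2) * (1 - `|w3| ^+ 2) - `|a2| ^+ 2))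
   \/
   (`|w2| = 1 /\ a1 = 0 /\ a2 = 0 /\
    `|b| ^+ 2 <= (1 - `|w1| ^+ 2) * (1 - `|w3| ^+ 2))).
Proof. by rewrite contraction_upper_tri3P; exact: row_form_criterion. Qed.
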